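(* Let $X=\mathbb{R}/\mathbb{Z}$ with its standard metric, $\mu_1=\mu_2$ Lebesgue measure, $(X,T_1,\mu_1)$ exponentially mixing for $BV$ against $L^\infty$, and $T_2(x)=x+\alpha\bmod 1$. Suppose there are a constant $c(\alpha)>0$ and a function $\varphi:\mathbb{N}\to(0,\infty)$ with $\varphi(q)\to\infty$ such that \[ |q\alpha-p|\ge c(\alpha)\,\frac{(\log q)\,\varphi(q)}{q^2} \] for all $p\in\mathbb{Z}$ and all sufficiently large $q\in\mathbb{N}$. Let $(r_n)_n$ be a sequence of positive numbers with $r_n\ge\frac{(\log n)h(n)}{n^2}$ for some function $h$ with $h(n)\to\infty$ and $h(n)/\varphi(n)\to0$ as $n\to\infty$. Then $(\mu_1\times\mu_2)(\limsup_n E_{n,r_n}^{T_1,T_2})=1$.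
   Context: $(X,T,\mu)$ is exponentially mixing for $BV$ against $L^\infty$ if there are $C,\theta>0$ such that for all $\psi$ of bounded variation, all $\varphi\in L^\infty(\mu)$ and all $n\ge0$, $\bigl|\int\psi\cdot\varphi\circ T^n\,d\mu-\int\psi\,d\mu\int\varphi\,d\mu\bigr|\le C\|\psi\|_{BV}\|\varphi\|_{L^\infty}e^{-\theta n}$. For $n\in\mathbb{N}$ and $r>0$, $E_{n,r}^{T_1,T_2}:=\{(x,y)\in X\times X : d(T_1^i x, T_2^j y)<r \text{ for some } 0\le i,j<n\}$; $E_{n,r_n}^{T_1,T_2}$ denotes this set with $r=r_n$. *)

(* Defs.v *)
From HB Require Import structures.
From mathcomp Require Import all_boot all_order all_algebra.
From mathcomp Require Import all_classical all_reals all_analysis.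
Set Implicit Arguments. Unset Strict Implicit. Unset Printing Implicit Defensive.
Import Order.TTheory GRing.Theory Num.Theory.
Local Open Scope classical_set_scope.
Local Open Scope ring_scope.

(* The circle X = R/Z is modelled by the fundamental domain [0,1) of R. *)
Section Circle.
Variable R : realType.

Definition frac (z : R) : R := z - (Num.floor z)%:~R.

Definition circ_dist (x y : R) : R := Num.min (frac (x - y)) (1 - frac (x - y)).

Definition circ_rot (alpha : R) (x : R) : R := frac (x + alpha).

Definition unit_itv : set R := `[0, 1[%classic.

Definition circ_integral (f : R -> R) : R :=
  Rintegral (@lebesgue_measure R) unit_itv f.

Definition BV_norm (psi : R -> R) : R :=
  sup [set `|psi x| | x in unit_itv] + fine (total_variation 0 1 psi).

Definition circ_mps (T : R -> R) : Prop :=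
  [/\ (forall x, unit_itv x -> unit_itv (T x)),
      measurable_fun unit_itv T &
      (forall A : set R, measurable A -> A `<=` unit_itv ->
         @lebesgue_measure R (T @^-1` A `&` unit_itv) = @lebesgue_measure R A)].

Definition exp_mixing_BV_Linf (T : R -> R) : Prop :=
  exists C theta : R, 0 < C /\ 0 < theta /\
    forall (psi phi : R -> R) (M : R) (n : nat),
      bounded_variation 0 1 psi ->
      measurable_fun unit_itv phi ->
      {ae @lebesgue_measure R, forall x, unit_itv x -> `|phi x| <= M} ->
      `| circ_integral (fun x => psi x * phi (iter n T x))
         - circ_integral psi * circ_integral phi |
      <= C * BV_norm psi * M * expR (- theta * n%:R).

Definition E_set (T1 T2 : R -> R) (n : nat) (r : R) : set (R * R) :=
  [set xy | exists i j : nat, (i < n)%N /\ (j < n)%N /\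
     circ_dist (iter i T1 xy.1) (iter j T2 xy.2) < r].

Definition limsup_sets (E : nat -> set (R * R)) : set (R * R) :=
  \bigcap_(N in setT) \bigcup_(n in [set n | (N <= n)%N]) E n.

End Circle.

(* Main.v *)
Require Import Defs.
From HB Require Import structures.
From mathcomp Require Import all_boot all_order all_algebra.
From mathcomp Require Import all_classical all_reals all_analysis.
From mathcomp Require Import measurable_realfun.
From mathcomp Require Import ring lra zify.
Import Order.TTheory GRing.Theory Num.Theory.
Local Open Scope classical_set_scope.
Local Open Scope ring_scope.
Set Implicit Arguments. Unset Strict Implicit.

(** For K > 0 put rho = K ln n / n^2.  Since varphi tends to infinity, for n
    large the points T2^j y (j < n) are 2 rho-separated, uniformly in y, so
    n intervals of length rho, one next to each T2^j y, are disjoint; their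
    union A has measure K ln n / n and an indicator of variation at most 2n.
    The number of i < n with T1^i x in A has mean K ln n; exponential mixing
    bounds its variance by O(K (ln n)^2), because correlations at time
    distance at least (3 / theta) ln n are negligible.  By Chebyshev the set
    of x missing A has measure O(1 / K), so for every y almost every x lies in
    infinitely many y-sections, and Fubini concludes. *)

(** * Second-moment inequality for a set that is never visited *)

(** With N the sum of the indicators of the [A i], N vanishes on [S], so a^2 1_S <= (N - a)^2 on
    [U]; integrating gives Chebyshev's bound. The terms are arranged without subtraction because the
    measures may be infinite. *)
Lemma second_moment_ineq (d : measure_display) (T : measurableType d)
    (R : realType) (mu : {measure set T -> \bar R}) (U S : set T)
    (A : nat -> set T) (n : nat) (a : R) :
  measurable U -> measurable S -> (forall i, measurable (A i)) ->
  S `<=` U -> (forall i, A i `<=` U) -> 0 <= a ->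
  (forall i x, (i < n)%N -> S x -> ~ A i x) ->
  ((a ^+ 2)%:E * mu S + (2 * a)%:E * (\sum_(i < n) mu (A i)) <=
   \sum_(i < n) \sum_(j < n) mu (A i `&` A j) + (a ^+ 2)%:E * mu U)%E.
Proof.
move=> mU mS mA SU AU a0 SA.
have mI (B : set T) : measurable B ->
    measurable_fun setT (fun x => (\1_B x : R)%:E : \bar R).
  by move=> mB; apply/measurable_EFinP; exact: measurable_indic.
have I0 (B : set T) x : (0 <= (\1_B x : R)%:E)%E by rewrite lee_fin.
have iE (B : set T) : measurable B -> mu B = (\int[mu]_x (\1_B x)%:E)%E.
  by move=> mB; rewrite integral_indic// setIT.
have a20 : 0 <= a ^+ 2 by exact: sqr_ge0.
have a0' : 0 <= 2 * a by rewrite mulr_ge0.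
have mAA i j : measurable (A i `&` A j) by exact: measurableI.
rewrite (iE S)// (iE U)//.
under eq_bigr do rewrite (iE _ (mA _)).
under [X in (_ <= X + _)%E]eq_bigr do (under eq_bigr do rewrite (iE _ (mAA _ _))).
under [X in (_ <= X + _)%E]eq_bigr => i _.
  rewrite -(@ge0_integral_sum _ _ _ mu setT measurableT _
    (fun (j : 'I_n) x => (\1_(A i `&` A j) x : R)%:E))//; last first.
    by move=> j; exact: mI.
  over.
have mIs i : measurable_fun setT
    (fun x => (\sum_(j < n) (\1_(A i `&` A j) x : R)%:E)%E).
  by apply: emeasurable_sum => j; exact: mI.
have mIS : measurable_fun setT (fun x => (\sum_(i < n) (\1_(A i) x : R)%:E)%E).
  by apply: emeasurable_sum => j; exact: mI.
rewrite -(@ge0_integral_sum _ _ _ mu setT measurableT _ (fun (i : 'I_n) x => (\1_(A i) x : R)%:E))//; last first.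
  by move=> j; exact: mI.
rewrite -(@ge0_integral_sum _ _ _ mu setT measurableT _
  (fun (i : 'I_n) x => (\sum_(j < n) (\1_(A i `&` A j) x : R)%:E)%E))//; last first.
  by move=> i x _; apply: sume_ge0.
have mISS : measurable_fun setT (fun x =>
    (\sum_(i < n) \sum_(j < n) (\1_(A i `&` A j) x : R)%:E)%E).
  by apply: emeasurable_sum => j; exact: mIs.
rewrite -!ge0_integralZl_EFin//; [|exact: mI|by move=> x _; exact: sume_ge0|exact: mI].
rewrite -!ge0_integralD//=; first last.
all: try by apply: measurable_funeM => //; exact: mI.
all: try by move=> x _; apply: mule_ge0; rewrite ?lee_fin//; exact: sume_ge0.
all: try by move=> x _; apply: sume_ge0 => ? _; exact: sume_ge0.
apply: ge0_le_integral => //=.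
- by move=> x _; apply: adde_ge0; apply: mule_ge0; rewrite ?lee_fin//; exact: sume_ge0.
- by apply: emeasurable_funD; apply: measurable_funeM => //; exact: mI.
- by apply: emeasurable_funD => //; apply: measurable_funeM => //; exact: mI.
move=> x _.
rewrite sumEFin.
under eq_bigr do rewrite sumEFin.
rewrite sumEFin -!EFinM -!EFinD lee_fin.
set N := \sum_(i < n) \1_(A i) x.
have -> : \sum_(i < n) \sum_(j < n) \1_(A i `&` A j) x = N ^+ 2 :> R.
  rewrite expr2 mulr_suml; apply: eq_bigr => i _.
  by rewrite mulr_sumr; apply: eq_bigr => j _; rewrite indicI.
(* On [S] both sides equal a^2, on the rest of [U] they differ by (N - a)^2, and off [U] every term
   is 0. *)
have [Sx|Sx] := pselect (S x).
  have -> : N = 0.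
    by apply: big1 => i _; rewrite indicE memNset//; exact: SA.
  by rewrite !indicE !mem_set//; [lra|exact: SU].
rewrite [\1_S x]indicE memNset//=.
have [Ux|Ux] := pselect (U x).
  rewrite indicE mem_set//=.
  rewrite -subr_ge0 [leRHS](_ : _ = (N - a) ^+ 2) ?sqr_ge0//; ring.
have -> : N = 0.
  by apply: big1 => i _; rewrite indicE memNset// => /AU.
by rewrite indicE memNset//=; lra.
Qed.

Lemma unit_itvE (R : realType) (x : R) : unit_itv x = (0 <= x < 1) :> Prop.
Proof. by rewrite /unit_itv/= in_itv. Qed.

Lemma unit_itv0 (R : realType) : unit_itv (0 : R).
Proof. by rewrite unit_itvE lexx ltr01. Qed.

(** * Variation of the indicator of a union of intervals *)

Section BVIntervals.
Variable R : realType.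
Implicit Types (a : nat -> R) (rho : R).

Definition itv_union a rho (n : nat) : set R :=
  \bigcup_(j in `I_n) `]a j, a j + rho[%classic.

Definition separated a rho (n : nat) : Prop :=
  forall i j, (i < n)%N -> (j < n)%N -> i <> j -> rho <= `|a i - a j|.

Lemma measurable_itv_union a rho n : measurable (itv_union a rho n).
Proof. by apply: bigcup_measurable => j _; exact: measurable_itv. Qed.

Lemma separated_itv_eq a rho n i j x : separated a rho n ->
  (i < n)%N -> (j < n)%N ->
  a i < x < a i + rho -> a j < x < a j + rho -> i = j.
Proof.
move=> sep ilt jlt xi xj; apply: contrapT => /(sep _ _ ilt jlt).
by rewrite leNgt => /negP; apply; rewrite ltr_norml; lra.
Qed.

Lemma lebesgue_itv_union a rho n : 0 < rho -> separated a rho n ->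
  lebesgue_measure (itv_union a rho n) = (n%:R * rho)%:E.
Proof.
move=> rho0 sep; rewrite /itv_union measure_fin_bigcup//; last first.
  move=> i j /= ilt jlt [x] [/=]; rewrite !in_itv/= => xi xj.
  exact: separated_itv_eq sep ilt jlt xi xj.
rewrite -fsbig_ord (eq_bigr (fun=> rho%:E)) => [|j _].
  by rewrite sumEFin sumr_const card_ord mulr_natl.
apply: (etrans (lebesgue_measure_itv _)).
by rewrite /= lte_fin ltrDl rho0 -EFinB addrAC subrr add0r.
Qed.

Let F a (n : nat) (x : R) : R := \sum_(j < n) (a j < x)%R%:R.
Let G a rho (n : nat) (x : R) : R := \sum_(j < n) (a j + rho <= x)%R%:R.

(** For open intervals, left endpoints below [x] minus right endpoints at or below [x] counts the
    intervals containing [x]; separation makes this count 0 or 1. Both counts are monotone, so their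
    variation is explicit. *)
Lemma indic_itv_union a rho n : 0 < rho -> separated a rho n ->
  \1_(itv_union a rho n) = F a n \+ (\- G a rho n).
Proof.
move=> rho0 sep; apply/funext => x /=.
rewrite /F /G -sumrB.
under eq_bigr => j _.
  rewrite (_ : _ - _ = (a j < x < a j + rho)%R%:R); last first.
    case: ltP => /= h1; last by rewrite lt_geF ?subrr//; lra.
    by rewrite ltNge; case: leP => _ /=; rewrite ?subrr ?subr0.
  over.
have [[i /= ilt]|nAx] := pselect (itv_union a rho n x).
  rewrite in_itv/= => xi.
  rewrite indicE mem_set; last by exists i => //=; rewrite in_itv.
  rewrite (bigD1 (Ordinal ilt))//= xi big1 ?addr0// => j ji.
  case: (boolP (_ < _ < _)) => // xj; exfalso.
  move/negP: ji; apply; apply/eqP/val_inj => /=.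
  exact: separated_itv_eq sep (ltn_ord j) ilt xj xi.
rewrite indicE memNset// big1// => j _.
case: (boolP (_ < _ < _)) => // xj; exfalso; apply: nAx.
by exists j => //=; rewrite ?in_itv.
Qed.

(** Each of the two monotone counts rises by at most [n] on [0,1]; the remaining 1 bounds the
    supremum. *)
Lemma bounded_variation_itv_union a rho n : 0 < rho -> separated a rho n ->
  bounded_variation 0 1 (\1_(itv_union a rho n) : R -> R) /\
  BV_norm (\1_(itv_union a rho n)) <= 1 + 2 * n%:R.
Proof.
move=> rho0 sep.
have ndF : {homo F a n : x y / x <= y}.
  move=> x y xy; apply: ler_sum => j _; rewrite ler_nat.
  by case: ltP => // ax; rewrite (lt_le_trans ax xy).
have ndG : {homo G a rho n : x y / x <= y}.
  move=> x y xy; apply: ler_sum => j _; rewrite ler_nat.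
  by case: leP => // ax; rewrite (le_trans ax xy).
have bv01 (f : 'I_n -> bool) : 0 <= (\sum_(j < n) (f j)%:R : R) <= n%:R.
  rewrite sumr_ge0//=.
  rewrite (le_trans (ler_sum _ (_ : forall j, true -> (f j)%:R <= 1)))//.
    by move=> j _; case: (f j).
  by rewrite sumr_const card_ord.
have tvF := @nondecreasing_total_variation R 0 1 (F a n) ler01 (in2W ndF).
have tvG := @nondecreasing_total_variation R 0 1 (G a rho n) ler01 (in2W ndG).
have bvF := @nondecreasing_bounded_variation R 0 1 (F a n) (in2W ndF).
have bvG := @nondecreasing_bounded_variation R 0 1 (G a rho n) (in2W ndG).
have bvI : bounded_variation 0 1 (\1_(itv_union a rho n) : R -> R).
  rewrite indic_itv_union//; apply: bounded_variationD => //.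
  exact: bounded_variationN.
split => //; rewrite /BV_norm lerD//.
  apply: ge_sup.
    by exists `|\1_(itv_union a rho n) 0|, 0 => //; exact: unit_itv0.
  by move=> _ [x _ <-]; rewrite indicE ger0_norm//; case: (_ \in _).
move/(bounded_variationP _ ler01): bvI => fin.
rewrite -lee_fin fineK// indic_itv_union//.
apply: (le_trans (total_variation_le _ _ ler01)).
rewrite total_variationN tvF tvG -EFinD lee_fin.
have /andP[F0 _] := bv01 (fun j => (a j < 0)%R).
have /andP[_ F1] := bv01 (fun j => (a j < 1)%R).
have /andP[G0 _] := bv01 (fun j => (a j + rho <= 0)%R).
have /andP[_ G1] := bv01 (fun j => (a j + rho <= 1)%R).
by rewrite /F /G; lra.
Qed.

End BVIntervals.

(** * Visits of a measure-preserving map to a set *)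

Section HittingTimes.
Variable R : realType.
Local Notation mu := (@lebesgue_measure R).
Local Notation U := (@unit_itv R).
Implicit Type T : R -> R.

Lemma measurable_unit_itv : measurable U.
Proof. exact: measurable_itv. Qed.

Lemma lebesgue_unit_itv : mu U = 1%E.
Proof. by rewrite /unit_itv lebesgue_measure_itv/= lte_fin ltr01 -EFinB subr0. Qed.

Lemma lebesgue_sub_unit_fin_num (A : set R) : measurable A -> A `<=` U ->
  mu A \is a fin_num.
Proof.
move=> mA AU; rewrite ge0_fin_numE//.
rewrite (@le_lt_trans _ _ (mu U))//; last by rewrite lebesgue_unit_itv ltry.
by apply: le_measure => //; rewrite inE//; exact: measurable_unit_itv.
Qed.

(** Cut down to [U] because [circ_mps] controls [T] only there. *)
Definition iter_preimage T (i : nat) (A : set R) : set R :=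
  [set x | U x /\ A (iter i T x)].

Lemma iter_unit_itv T i x : circ_mps T -> U x -> U (iter i T x).
Proof. by move=> [TU _ _] Ux; elim: i => //= i; exact: TU. Qed.

Lemma measurable_fun_iter T i : circ_mps T -> measurable_fun U (iter i T).
Proof.
move=> mps; have [TU mT _] := mps.
elim: i => [|i IH]; first exact: measurable_id.
apply: (@measurable_comp _ _ _ _ _ _ U) => //; first exact: measurable_unit_itv.
by move=> _ [x Ux <-]; exact: iter_unit_itv.
Qed.

Lemma measurable_iter_preimage T i A : circ_mps T -> measurable A ->
  measurable (iter_preimage T i A).
Proof.
move=> mps mA.
exact: (measurable_fun_iter i mps) measurable_unit_itv _ mA.
Qed.

Lemma lebesgue_iter_preimage T i A : circ_mps T -> measurable A -> A `<=` U ->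
  mu (iter_preimage T i A) = mu A.
Proof.
move=> mps; have [TU mT pT] := mps.
elim: i A => [|i IH] A mA AU.
  by congr (mu _); apply/seteqP; split => [x [_]//|x Ax]; split => //; exact: AU.
rewrite -(pT A mA AU) -(IH (T @^-1` A `&` U)).
- congr (mu _); apply/seteqP; split => x /= [Ux].
    by move=> Ax; split => //; split => //; exact: iter_unit_itv.
  by move=> -[].
- by rewrite setIC; exact: (mT measurable_unit_itv _ mA).
- by move=> x [].
Qed.

(** The left-hand set is the preimage under [iter i T] of the right-hand one. This stationarity
    reduces every pair of times to a correlation at lag [k], the form that mixing bounds. *)
Lemma lebesgue_iter_preimageI T i k A : circ_mps T -> measurable A ->
  A `<=` U ->
  mu (iter_preimage T i A `&` iter_preimage T (k + i) A) =
  mu (A `&` iter_preimage T k A).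
Proof.
move=> mps mA AU.
have mAk := measurable_iter_preimage k mps mA.
rewrite -(@lebesgue_iter_preimage T i (A `&` iter_preimage T k A))//.
- congr (mu _); apply/seteqP; split => x.
    move=> [[Ux Ai] [_]]; rewrite iterD => Aki; split => //; split => //.
    by split => //; exact: AU.
  by move=> [Ux [Ai [_ Aki]]]; split; split => //; rewrite iterD.
- exact: measurableI.
- by move=> x [/AU].
Qed.

(** Counts the near-diagonal entries of one row: they lie in the window of length [2 * D] starting
    at [i - D], and truncation of the subtraction at 0 loses none of them. *)
Lemma count_near_le (n D i : nat) :
  (\sum_(j < n) ((j < i + D) && (i < j + D)) <= 2 * D)%N.
Proof.
rewrite -(big_mkord xpredT (fun j => nat_of_bool ((j < i + D) && (i < j + D))%N)).
rewrite -big_mkcond/= sum1_count -size_filter.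
rewrite -(size_iota (i - D) (2 * D)); apply: uniq_leq_size.
  by rewrite filter_uniq// iota_uniq.
by move=> j; rewrite mem_filter mem_iota => /andP[/andP[? ?] _]; lia.
Qed.

(* Chebyshev's inequality for the number of visits to [A]: near-diagonal
   correlations are bounded trivially by [mu A], the others by mixing. *)
Lemma non_hitting_measure T (C theta B m : R) (A : set R) (n D : nat) :
  circ_mps T -> 0 <= C -> 0 < theta ->
  (forall (psi phi : R -> R) (M : R) (n : nat),
    bounded_variation 0 1 psi -> measurable_fun U phi ->
    {ae mu, forall x, U x -> `|phi x| <= M} ->
    `| circ_integral (fun x => psi x * phi (iter n T x))
       - circ_integral psi * circ_integral phi |
    <= C * BV_norm psi * M * expR (- theta * n%:R)) ->
  measurable A -> A `<=` U -> bounded_variation 0 1 (\1_A : R -> R) ->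
  BV_norm \1_A <= B -> 0 <= B -> mu A = m%:E ->
  let S := [set x | U x /\ forall i, (i < n)%N -> ~ A (iter i T x)] in
  measurable S /\
  (((n%:R * m) ^+ 2)%:E * mu S <=
   (2 * n%:R * D%:R * m + n%:R ^+ 2 * (C * B * expR (- theta * D%:R)))%:E)%E.
Proof.
move=> mps C0 th0 mix mA AU bvA BA B0 muA S.
have m0 : 0 <= m by rewrite -lee_fin -muA.
set P := fun i => iter_preimage T i A.
have mP i : measurable (P i) by exact: measurable_iter_preimage.
have PU i : P i `<=` U by move=> x [].
have muP i : mu (P i) = m%:E by rewrite lebesgue_iter_preimage.
have mS : measurable S.
  rewrite (_ : S = U `\` \bigcup_(i in `I_n) P i).
    apply: measurableD; first exact: measurable_unit_itv.
    by apply: bigcup_measurable => i _; exact: mP.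
  apply/seteqP; split => x.
    by move=> [Ux Sx]; split => // -[i /= ilt [_]]; exact: Sx.
  by move=> [Ux Sx]; split => // i ilt Ai; apply: Sx; exists i.
split => //.
have mPP i j : measurable (P i `&` P j) by exact: measurableI.
have finPP i j : mu (P i `&` P j) \is a fin_num.
  by apply: lebesgue_sub_unit_fin_num => // x [/PU].
set p := fun i j => fine (mu (P i `&` P j)).
have pm i j : p i j <= m.
  rewrite -lee_fin /p fineK// -(muP i).
  by apply: le_measure => [||x []//]; rewrite inE; [exact: mPP|exact: mP].
have int_indic (E : set R) : measurable E -> E `<=` U ->
    circ_integral (\1_E) = fine (mu E).
  move=> mE EU; rewrite /circ_integral /Rintegral integral_indic//.
    by rewrite setIidl.
  exact: measurable_unit_itv.
set K := C * B * expR (- theta * D%:R).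
have K0 : 0 <= K by rewrite !mulr_ge0// expR_ge0.
(* Mixing is applied with both observables equal to the indicator of [A] and bound 1; the error
   decreases with the lag, so its value at lag [D] serves for all longer lags. *)
have pmix i k : (D <= k)%N -> p i (k + i)%N <= m ^+ 2 + K.
  move=> Dk; rewrite /p lebesgue_iter_preimageI//.
  have AU1 : {ae mu, forall x, U x -> `|\1_A x| <= 1 :> R}.
    apply: aeW => x _; rewrite indicE ger0_norm//.
    by case: (_ \in _).
  have mI : measurable_fun U (\1_A : R -> R) by exact: measurable_indic.
  have := mix _ \1_A 1 k bvA mI AU1.
  rewrite [circ_integral \1_A]int_indic// muA/=.
  rewrite [circ_integral _](_ : _ = fine (mu (A `&` P k))); last first.
    rewrite -int_indic; last 2 first.
    - exact: measurableI.
    - by move=> x [/AU].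
    apply: eq_Rintegral => x /set_mem Ux; rewrite /= !indicE -natrM mulnb in_setI.
    congr ((_ && _)%:R).
    by apply/idP/idP => /set_mem; [move=> ?; apply/mem_set; split|move=> [_ ?]; exact/mem_set].
  move=> /ler_normlP[_]; rewrite lerBlDl => /le_trans; apply.
  rewrite expr2 lerD2l mulr1 /K.
  apply: ler_pM => //; rewrite ?expR_ge0//.
  - rewrite mulr_ge0// /BV_norm addr_ge0//; last first.
      by rewrite fine_ge0// total_variation_ge0.
    apply: (@le_trans _ _ `|\1_A 0 : R|) => //.
    apply: ub_le_sup; last by exists 0 => //; exact: unit_itv0.
    by exists 1 => _ [x _ <-]; rewrite indicE ger0_norm//; case: (_ \in _).
  - by rewrite ler_wpM2l.
  - rewrite ler_expR !mulNr lerN2 ler_wpM2l//; [exact: ltW|by rewrite ler_nat].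
(* Pairs at distance below [D] pay the trivial bound [m], all others the mixing error; symmetry of
   the intersection covers [j] below [i]. *)
have pb i j : p i j <= m ^+ 2 + (m * ((j < i + D) && (i < j + D))%N%:R + K).
  case: (boolP (_ && _)) => [_|].
    by rewrite mulr1 (le_trans (pm i j))//; have := sqr_ge0 m; lra.
  rewrite mulr0 add0r negb_and -!leqNgt => /orP[h|h].
    rewrite (_ : j = (j - i) + i)%N; last lia.
    by apply: pmix; lia.
  rewrite /p setIC -/(p j i) (_ : i = (i - j) + j)%N; last lia.
  by apply: pmix; lia.
have nm0 : 0 <= n%:R * m by rewrite mulr_ge0.
have nS i x : (i < n)%N -> S x -> ~ P i x by move=> ? [_ Sx] [_]; exact: Sx.
(* The level [a] is the mean number of visits n m, so the (n m)^2 terms other than the factor of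
   [mu S] cancel and only the variance bound remains. *)
have : (((n%:R * m) ^+ 2)%:E * mu S + (2 * (n%:R * m))%:E * (\sum_(i < n) mu (P i)) <=
    \sum_(i < n) \sum_(j < n) mu (P i `&` P j) + ((n%:R * m) ^+ 2)%:E * mu U)%E.
  refine (@second_moment_ineq _ _ R mu U S P n _ measurable_unit_itv mS mP _ PU nm0 nS).
  by move=> x [].
rewrite lebesgue_unit_itv mule1.
under eq_bigr do rewrite muP.
rewrite sumEFin sumr_const card_ord -EFinM.
under [X in (_ <= X + _)%E -> _]eq_bigr => i _.
  under eq_bigr do rewrite -(fineK (finPP _ _)).
  rewrite sumEFin.
  over.
rewrite sumEFin -EFinD.
have finS : mu S \is a fin_num by apply: lebesgue_sub_unit_fin_num => // x [].
rewrite -(fineK finS) -EFinM -EFinD !lee_fin.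
set q := \sum_(i < n) _.
have qle : q <= n%:R ^+ 2 * m ^+ 2 + (2 * n%:R * D%:R * m + n%:R ^+ 2 * K).
  apply: (@le_trans _ _ (\sum_(i < n) (n%:R * m ^+ 2 + (m * (2 * D%:R) + n%:R * K)))).
    apply: ler_sum => i _.
    apply: (@le_trans _ _ (\sum_(j < n)
        (m ^+ 2 + (m * ((j < i + D) && (i < j + D))%N%:R + K)))).
      by apply: ler_sum => j _; exact: pb.
    rewrite big_split/= sumr_const card_ord -[m ^+ 2 *+ n]mulr_natl lerD2l.
    rewrite big_split/= sumr_const card_ord -[K *+ n]mulr_natl lerD2r.
    rewrite -mulr_sumr ler_wpM2l// -natr_sum -natrM ler_nat.
    exact: count_near_le.
  rewrite sumr_const card_ord -[leLHS]mulr_natl le_eqVlt; apply/orP; left; apply/eqP.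
  by ring.
rewrite -[m *+ n]mulr_natl.
move=> h; rewrite -/K in qle *; move: h qle; rewrite exprMn.
set s := fine _; nra.
Qed.

End HittingTimes.

(** * Diophantine lower bounds along the orbit *)

Section Separation.
Variable R : realType.

Lemma ln_nat_ge1 : exists N : nat, forall n, (N <= n)%N -> 1 <= ln (n%:R : R).
Proof.
exists (Num.truncn (expR 1 : R)).+1 => n Nn.
have e1n : expR 1 <= n%:R :> R.
  apply: (le_trans (ltW (truncnS_gt (expR 1 : R)))).
  by rewrite ler_nat.
rewrite -[leLHS]expRK ler_ln// posrE ?expR_gt0//.
exact: lt_le_trans (expR_gt0 1) e1n.
Qed.

(** With y = t x the claim is ln x + ln t <= t^2 ln x, which follows from ln t <= t - 1 <= t^2 - 1
    and ln x >= 1. *)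
Lemma ln_div_sqr_le (x y : R) : 0 < x -> 1 <= ln x -> x <= y ->
  ln y / y ^+ 2 <= ln x / x ^+ 2.
Proof.
move=> x0 lx xy; have y0 : 0 < y := lt_le_trans x0 xy.
rewrite ler_pdivrMr ?exprn_gt0// mulrAC -mulrA -expr_div_n.
set t := y / x.
have t1 : 1 <= t by rewrite /t ler_pdivlMr// mul1r.
have -> : y = x * t by rewrite /t mulrC divfK// gt_eqF.
rewrite lnM ?posrE//; last exact: lt_le_trans t1.
have : ln t <= t - 1.
  by have := @le_ln1Dx R (t - 1); rewrite [1 + _]addrC subrK; apply; lra.
have h1 : 0 <= (ln x - 1) * (t ^+ 2 - 1).
  by rewrite mulr_ge0 ?subr_ge0// expr_ge1//; lra.
have h2 : 0 <= t * (t - 1) by rewrite mulr_ge0 ?subr_ge0//; lra.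
nra.
Qed.

(** For large [q], c varphi(q) >= K and ln q / q^2 decreases, so the bound at [q] dominates the one
    required at [n]. The finitely many small [q] keep q alpha at distance at least some [delta] from
    the integers, and K ln n / n^2 eventually falls below [delta]. *)
Lemma separation_of_orbit (alpha c : R) (varphi : nat -> R) :
  0 < c -> (forall q, 0 < varphi q) -> varphi q @[q --> \oo] --> +oo ->
  (exists Q : nat, forall q : nat, (Q <= q)%N -> forall p : int,
    c * (ln q%:R * varphi q) / (q%:R ^+ 2) <= `|q%:R * alpha - p%:~R|) ->
  forall K : R, 0 < K -> exists N : nat, forall n, (N <= n)%N ->
    forall q : nat, (0 < q < n)%N -> forall p : int,
    K * ln n%:R / n%:R ^+ 2 <= `|q%:R * alpha - p%:~R|.
Proof.
move=> c0 phi0 phioo [Q HQ] K K0.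
have [N1 HN1] := ln_nat_ge1.
have [N2 _ HN2] : \forall q \near \oo, K / c <= varphi q.
  by move/cvgryPge : phioo; apply.
(* From [q0] on, the Diophantine bound, ln q >= 1 and varphi(q) >= K / c all hold; the successor
   makes [q0] positive. *)
set q0 := (Q + N1 + N2).+1.
have ln1 q : (q0 <= q)%N -> 1 <= ln (q%:R : R).
  by move=> ?; apply: HN1; lia.
have qpos q : (0 < q)%N -> 0 < q%:R :> R by rewrite ltr0n.
(* Small [q] are reached through the multiple [q0 * q]. *)
have [delta [delta0 Hdelta]] : exists delta : R, 0 < delta /\
    forall q, (0 < q < q0)%N -> forall p : int,
    delta <= `|q%:R * alpha - p%:~R|.
  suff H k : exists delta : R, 0 < delta /\
      forall q, (0 < q < k)%N -> forall p : int,
      delta <= `|q%:R * alpha - p%:~R| by exact: H.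
  elim: k => [|k [delta [delta0 Hdelta]]]; first by exists 1; split => // q; lia.
  have [->|k0] := posnP k.
    by exists 1; split => // q; lia.
  set s := (q0 * k)%N.
  have q0s : (q0 <= s)%N by rewrite leq_pmulr.
  have s0 : 0 < s%:R :> R by rewrite qpos//; lia.
  (* Since |k alpha - p| q0 = |s alpha - q0 p|, the bound at [s] is divided by [q0]. *)
  set d' := c * (ln s%:R * varphi s) / (s%:R ^+ 2) / q0%:R.
  have d'0 : 0 < d'.
    rewrite divr_gt0 ?qpos// divr_gt0 ?exprn_gt0// mulr_gt0// mulr_gt0//.
    exact: lt_le_trans (ln1 _ q0s).
  exists (Num.min delta d'); split; first by rewrite lt_min delta0.
  move=> q /andP[q_gt0]; rewrite ltnS leq_eqVlt => /orP[/eqP ->|qk] p.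
    rewrite ge_min; apply/orP; right.
    rewrite ler_pdivrMr ?qpos//.
    rewrite (_ : `|_| * _ = `|(k%:R * alpha - p%:~R) * q0%:R|); last first.
      by rewrite normrM [`|q0%:R|]gtr0_norm// qpos.
    have -> : (k%:R * alpha - p%:~R) * q0%:R =
        s%:R * alpha - (p * q0%:Z)%:~R by rewrite /s natrM intrM; ring.
    by apply: HQ; lia.
  by rewrite ge_min Hdelta// q_gt0.
(* For n >= K / delta, ln n < n gives K ln n / n^2 <= K / n <= delta. *)
exists (maxn q0 (Num.truncn (K / delta)).+1) => n; rewrite geq_max => /andP[q0n Dn].
move=> q /andP[q_gt0 qn] p.
have n0 : 0 < n%:R :> R by rewrite qpos//; lia.
have [qq0|q0q] := ltnP q q0.
  apply: le_trans (Hdelta q _ p); last by rewrite q_gt0.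
  rewrite ler_pdivrMr ?exprn_gt0// expr2 mulrA.
  apply: ler_pM; [exact: ltW|by apply: ln_ge0; rewrite ler1n; lia| |].
    rewrite mulrC -ler_pdivrMr//.
    by apply: (le_trans (ltW (truncnS_gt _))); rewrite ler_nat.
  exact: ltW (ln_sublinear _).
apply: le_trans (HQ q _ p); last lia.
rewrite -mulrA.
apply: (@le_trans _ _ (K * (ln q%:R / q%:R ^+ 2))).
  rewrite ler_pM2l// ln_div_sqr_le// ?qpos// ?ln1//.
  by rewrite ler_nat ltnW.
have lq := ln1 _ q0q.
have -> : c * (ln q%:R * varphi q) / q%:R ^+ 2 =
  (c * varphi q) * (ln q%:R / q%:R ^+ 2) by ring.
rewrite ler_wpM2r ?divr_ge0 ?sqr_ge0//; first lra.
have : K / c <= varphi q by apply: HN2 => /=; lia.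
by rewrite ler_pdivrMr// mulrC.
Qed.

End Separation.

(** * Rotation orbits and one-sided intervals *)

Section Rotation.
Variable R : realType.
Local Notation U := (@unit_itv R).

Lemma frac_unit_itv (z : R) : U (Defs.frac z).
Proof.
rewrite unit_itvE /Defs.frac; have := floor_le z; have := floorD1_gt z.
by rewrite intrD; lra.
Qed.

Lemma frac_id (z : R) : U z -> Defs.frac z = z.
Proof.
rewrite unit_itvE /Defs.frac => z01.
by rewrite (_ : Num.floor z = 0) ?subr0//; apply/eqP; rewrite floor_eq; lra.
Qed.

(** If u < v, the fractional part of u - v is 1 - |u - v|, and the two arguments of the minimum
    change places. *)
Lemma circ_distE (u v : R) : U u -> U v ->
  circ_dist u v = Num.min `|u - v| (1 - `|u - v|).
Proof.
rewrite !unit_itvE /circ_dist => u01 v01.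
have [vu|uv] := leP v u.
  rewrite frac_id ?ger0_norm//; [lra|rewrite unit_itvE; lra].
have -> : Defs.frac (u - v) = u - v + 1.
  rewrite /Defs.frac (_ : Num.floor (u - v) = -1); first by rewrite mulrN1z opprK.
  by apply/eqP; rewrite floor_eq mulrN1z intrD mulrN1z; lra.
rewrite ltr0_norm; last lra.
by rewrite minC; congr Num.min; lra.
Qed.

(** Lifts the orbit to the real line: [k] collects the integer parts removed on the way. *)
Lemma iter_circ_rotE (alpha y : R) j :
  exists k : int, iter j (circ_rot alpha) y = y + j%:R * alpha - k%:~R.
Proof.
elim: j => [|j [k IH]]; first by exists 0; rewrite mul0r addr0 subr0.
exists (k + Num.floor (iter j (circ_rot alpha) y + alpha)).
rewrite iterS {1}/circ_rot /Defs.frac IH intrD -natr1; ring.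
Qed.

Lemma iter_circ_rot_unit_itv (alpha y : R) j :
  U y -> U (iter j (circ_rot alpha) y).
Proof. by move=> Uy; case: j => [//|j]; exact: frac_unit_itv. Qed.

(* The one-sided interval at [z] that does not wrap around the circle. *)
Definition side_start (rho z : R) : R := if z < 2^-1 then z else z - rho.

Lemma side_itvP (rho z u : R) : U z -> 0 < rho <= 2^-1 ->
  side_start rho z < u < side_start rho z + rho ->
  U u /\ circ_dist u z < rho.
Proof.
move=> Uz rho01 zu; have Uu : U u.
  by move: Uz zu; rewrite !unit_itvE /side_start; case: (ltP z 2^-1) => h1 h2 h3; lra.
split => //; rewrite circ_distE// gt_min; apply/orP; left.
by move: zu; rewrite ltr_norml /side_start; case: (ltP z 2^-1) => h1 h2; lra.
Qed.

(** Each start is its point shifted left by 0 or [rho], so the gap shrinks by at most [rho]. *)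
Lemma side_start_dist (rho z w : R) : 0 < rho -> 2 * rho <= `|z - w| ->
  rho <= `|side_start rho z - side_start rho w|.
Proof.
rewrite /side_start => rho0; rewrite !ler_normr => H; apply/orP; move: H.
by do 2 case: ifP => _; move=> /orP[H|H]; [left|right|left|right|left|right|left|right]; lra.
Qed.

End Rotation.

(** * Points that miss the rotation orbit of [y] *)

Section Limsup.
Variable R : realType.
Local Notation mu := (@lebesgue_measure R).
Local Notation U := (@unit_itv R).

(** Two orbit points differ by q alpha - p with q = j - i, whatever [y] is; the factor 2 pays for
    the shifts in [side_start]. *)
Lemma orbit_side_itv_separated (alpha rho : R) (n : nat) (y : R) : 0 < rho ->
  (forall q : nat, (0 < q < n)%N -> forall p : int,
    2 * rho <= `|q%:R * alpha - p%:~R|) ->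
  separated (fun j => side_start rho (iter j (circ_rot alpha) y)) rho n.
Proof.
move=> rho0 sep i j.
wlog ij : i j / (i < j)%N.
  move=> H ilt jlt /eqP; rewrite neq_ltn => /orP[ij|ji].
    by apply: H => //; lia.
  by rewrite distrC; apply: H => //; lia.
move=> _ jlt _; apply: side_start_dist => //.
have [k ->] := iter_circ_rotE alpha y i; have [l ->] := iter_circ_rotE alpha y j.
have h := sep (j - i)%N _ (l - k); rewrite distrC.
rewrite (_ : _ - _ = (j - i)%N%:R * alpha - (l - k)%:~R); first by apply: h; lia.
by rewrite natrB ?(ltnW ij)// intrB; ring.
Qed.

(** The missing set has measure at most M / K with [M] independent of [n], so [K] is chosen from
    [eps] first and then [n] large in terms of [K]. *)
Lemma non_hitting_small (T1 : R -> R) (alpha c : R) (varphi h r : nat -> R) :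
  circ_mps T1 -> exp_mixing_BV_Linf T1 ->
  0 < c -> (forall q, 0 < varphi q) -> varphi q @[q --> \oo] --> +oo ->
  (exists Q : nat, forall q : nat, (Q <= q)%N -> forall p : int,
    c * (ln q%:R * varphi q) / (q%:R ^+ 2) <= `|q%:R * alpha - p%:~R|) ->
  h n @[n --> \oo] --> +oo ->
  (forall n, ln n%:R * h n / (n%:R ^+ 2) <= r n) ->
  forall y, U y -> forall eps : R, 0 < eps -> forall N : nat,
  exists (n : nat) (S : set R), [/\ (N <= n)%N, measurable S,
    (mu S <= eps%:E)%E &
    forall x, U x -> ~ E_set T1 (circ_rot alpha) n (r n) (x, y) -> S x].
Proof.
move=> mps [C [theta [C0 [th0 mix]]]] c0 phi0 phioo Hphi hoo Hr y Uy eps eps0 N.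
(* [6 / theta + 2] comes from the near-diagonal pairs and [3 * C] from the mixing error. *)
pose M := 6 / theta + 2 + 3 * C.
have th'0 : 0 < 6 / theta by rewrite divr_gt0.
pose K := 1 + M / eps.
have Me0 : 0 < M / eps by rewrite divr_gt0// /M; lra.
have K1 : 1 <= K by rewrite /K; lra.
have MK : M <= K * eps by rewrite /K mulrDl divfK ?gt_eqF//; lra.
clearbody K.
have [N1 HN1] := ln_nat_ge1 R.
have [N2 HN2] : exists N2 : nat, forall n, (N2 <= n)%N ->
    forall q : nat, (0 < q < n)%N -> forall p : int,
    2 * K * ln n%:R / n%:R ^+ 2 <= `|q%:R * alpha - p%:~R|.
  by apply: (separation_of_orbit c0 phi0 phioo Hphi); lra.
have [N3 _ HN3] : \forall n \near \oo, K <= h n by move/cvgryPge : hoo; apply.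
have [n [Nn N1n N2n N3n Kn]] : exists n, [/\ (N <= n)%N, (N1 <= n)%N,
    (N2 <= n)%N, (N3 <= n)%N & (Num.truncn (2 * K) < n)%N].
  set k := Num.truncn _; clearbody k.
  by exists (N + N1 + N2 + N3 + k).+1; split; lia.
have {}Kn : 2 * K <= n%:R.
  by apply: (le_trans (ltW (truncnS_gt _))); rewrite ler_nat.
have n1 : 1 <= n%:R :> R by lra.
have n0 : 0 < n%:R :> R by lra.
pose L : R := ln n%:R.
have L1 : 1 <= L by exact: HN1.
have Kh : K <= h n by exact: HN3.
pose rho := K * L / n%:R ^+ 2.
have rho0 : 0 < rho by rewrite divr_gt0 ?exprn_gt0//; nra.
(* By ln n < n and 2 K <= n, rho is below K / n <= 1/2; this keeps the intervals inside [0,1). *)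
have rho2 : rho <= 2^-1.
  rewrite ler_pdivrMr ?exprn_gt0//.
  have : L < n%:R by exact: ln_sublinear.
  nra.
have rho_r : rho <= r n.
  apply: le_trans (Hr n); rewrite ler_pM2r ?invr_gt0 ?exprn_gt0//.
  by rewrite mulrC ler_pM2l//; lra.
pose z j := iter j (circ_rot alpha) y.
have Uz j : U (z j) by exact: iter_circ_rot_unit_itv.
pose a j := side_start rho (z j).
have sep : separated a rho n.
  apply: orbit_side_itv_separated => // q qn p.
  by rewrite /rho !mulrA; exact: HN2.
pose A := itv_union a rho n.
have AU : A `<=` U.
  move=> u [j /= _]; rewrite in_itv/= => /(side_itvP (Uz j)) H.
  by apply: (H _).1; rewrite rho0.
have [bvA BA] := bounded_variation_itv_union rho0 sep.
(* This lag makes exp(- theta D) <= n^(-3), which compensates n^2 times the variation bound 1 + 2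
   n. *)
pose D := (Num.truncn (3 * L / theta)).+1.
have D1 : 3 * L <= theta * D%:R.
  by rewrite [leRHS]mulrC -ler_pdivrMr//; exact/ltW/truncnS_gt.
have D2 : D%:R <= 3 * L / theta + 1.
  rewrite /D -natr1 lerD2r truncn_le// divr_ge0//; lra.
have B0 : 0 <= 1 + 2 * n%:R :> R by lra.
have [mS] := @non_hitting_measure R T1 C theta _ (n%:R * rho) A n D mps (ltW C0) th0 mix
  (measurable_itv_union _ _ _) AU bvA BA B0 (lebesgue_itv_union rho0 sep).
set S := [set x | _] => HS.
exists n, S; split => //.
- have finS : mu S \is a fin_num by apply: lebesgue_sub_unit_fin_num => // x [].
  move: HS; rewrite -(fineK finS) -EFinM !lee_fin.
  set s := fine _ => HS.
  have nnr : n%:R * (n%:R * rho) = K * L.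
    by rewrite /rho; field; rewrite gt_eqF.
  have expD : n%:R ^+ 2 * (C * (1 + 2 * n%:R) * expR (- theta * D%:R)) <= 3 * C.
    have e3 : expR (- theta * D%:R) <= (n%:R ^+ 3)^-1.
      rewrite -[X in X ^+ 3](@lnK R n%:R) ?posrE// -expRM_natl -expRN ler_expR.
      by rewrite mulNr lerN2 mulrC -[ln _]/L; lra.
    have e4 : n%:R ^+ 2 * (C * (1 + 2 * n%:R)) <= 3 * C * n%:R ^+ 3.
      rewrite (_ : 3 * C * _ = n%:R ^+ 2 * (C * (3 * n%:R))); last ring.
      by rewrite ler_pM2l ?exprn_gt0// ler_pM2l//; lra.
    rewrite mulrA; apply: (le_trans (ler_wpM2l _ e3)).
      by rewrite mulr_ge0 ?sqr_ge0// mulr_ge0// ltW.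
    by rewrite ler_pdivrMr ?exprn_gt0.
  have KL2 : 1 <= K * L ^+ 2.
    by rewrite -[leLHS]mulr1; apply: ler_pM => //; rewrite expr_ge1//; lra.
  (* The mean number of visits is K L, and D <= 3 L / theta + 1 with L >= 1. *)
  have nD : 2 * n%:R * D%:R * (n%:R * rho) <= (6 / theta + 2) * (K * L ^+ 2).
    rewrite (_ : 2 * _ * _ * _ = 2 * D%:R * (n%:R * (n%:R * rho))); last ring.
    rewrite nnr (_ : (_ + _) * _ = (6 / theta * L + 2 * L) * (K * L)); last ring.
    rewrite ler_wpM2r//; first nra.
    have -> : 6 / theta * L = 2 * (3 * L / theta) by ring.
    lra.
  rewrite nnr in HS.
  (* Cancelling K L^2 leaves K s <= M <= K eps. *)
  have {}HS : K * L ^+ 2 * (K * s) <= K * L ^+ 2 * M.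
    rewrite (_ : _ * (K * s) = (K * L) ^+ 2 * s); last ring.
    apply: (le_trans HS); rewrite /M [leRHS]mulrDr; apply: lerD.
      by rewrite [leRHS]mulrC.
    apply: (le_trans expD); rewrite ler_peMl//; lra.
  rewrite ler_pM2l in HS; last lra.
  rewrite -(@ler_pM2l _ K); last lra.
  exact: le_trans HS MK.
(* A visit to the interval next to [z j] would bring the two orbits within rho <= r_n, which is
   excluded outside [E_set]. *)
- move=> x Ux nE; split => // i ilt [j /= jlt].
  rewrite in_itv/= => /(side_itvP (Uz j)) H; apply: nE; exists i, j; split => //.
  by split => //; apply: lt_le_trans rho_r; apply: (H _).2; rewrite rho0.
Qed.

(** * Measurability of the hitting sets *)

Lemma measurable_fun_frac : measurable_fun setT (@Defs.frac R).
Proof.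
apply: measurable_funB; first exact: measurable_id.
apply: nondecreasing_measurable => // x y xy.
by rewrite ler_int; exact: le_floor.
Qed.

Lemma measurable_fun_circ_rot (alpha : R) :
  measurable_fun setT (@circ_rot R alpha).
Proof.
apply: (measurableT_comp measurable_fun_frac).
by apply: measurable_funD => //; exact: measurable_cst.
Qed.

Lemma measurable_fun_iter_circ_rot (alpha : R) j :
  measurable_fun setT (iter j (@circ_rot R alpha)).
Proof.
elim: j => [|j IH]; first exact: measurable_id.
exact: measurableT_comp (measurable_fun_circ_rot alpha) IH.
Qed.

(** A finite union, over pairs of times, of sublevel sets of a distance; it is taken inside the unit
    square because [T1] is known to be measurable only on [U]. *)
Lemma measurable_E_set (T1 : R -> R) (alpha rho : R) (n : nat) :
  circ_mps T1 ->
  measurable (E_set T1 (circ_rot alpha) n rho `&` (U `*` U)).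
Proof.
move=> mps.
have mUU : measurable (U `*` U) by apply: measurableX; exact: measurable_unit_itv.
rewrite (_ : _ `&` _ = \bigcup_(i in `I_n) \bigcup_(j in `I_n)
  ((U `*` U) `&` (fun xy => circ_dist (iter i T1 xy.1)
      (iter j (circ_rot alpha) xy.2)) @^-1` `]-oo, rho[%classic)); last first.
  apply/seteqP; split.
    move=> [x y] [[i [j [ilt [jlt d]]]] Uxy].
    by exists i => //; exists j => //; split => //=; rewrite in_itv.
  move=> [x y] [i ilt [j jlt [Uxy]]]; rewrite /= in_itv/= => d.
  by split => //; exists i, j.
apply: bigcup_measurable => i _; apply: bigcup_measurable => j _.
have mD : measurable_fun (U `*` U)
    (fun xy : R * R => iter i T1 xy.1 - iter j (circ_rot alpha) xy.2).
  apply: measurable_funB.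
    apply: (@measurable_comp _ _ _ _ _ _ U _ _ fst).
    - exact: measurable_unit_itv.
    - by move=> _ [[x y] [Ux _] <-].
    - exact: measurable_fun_iter.
    - by apply: measurable_funTS; exact: measurable_fst.
  apply: measurable_funTS.
  exact: (measurableT_comp (measurable_fun_iter_circ_rot alpha j) measurable_snd).
have mfr := measurableT_comp measurable_fun_frac mD.
have := measurable_minr mfr (measurable_funB (measurable_cst (1 : R)) mfr).
by apply => //; exact: measurable_itv.
Qed.

End Limsup.

(** * Sections of full measure and Fubini *)

(** For every [eps], what a tail union misses in [U] lies in some [S] of measure at most [eps], so
    it is null; there are countably many tails. Unlike in Borel-Cantelli, no summability or
    independence enters. *)
Lemma limsup_section_full (R : realType) (E : nat -> set (R * R)) (y : R) :
  (forall n, measurable (E n `&` (@unit_itv R `*` @unit_itv R))) ->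
  unit_itv y ->
  (forall eps : R, 0 < eps -> forall N : nat,
    exists (n : nat) (S : set R), [/\ (N <= n)%N, measurable S,
      (@lebesgue_measure R S <= eps%:E)%E &
      forall x, unit_itv x -> ~ E n (x, y) -> S x]) ->
  @lebesgue_measure R
    (ysection (limsup_sets E `&` (@unit_itv R `*` @unit_itv R)) y) = 1%E.
Proof.
move=> mE Uy HE; set U := @unit_itv R; set L := ysection _ _.
pose V N := \bigcup_(n in [set n | (N <= n)%N]) ysection (E n `&` (U `*` U)) y.
have mV N : measurable (V N).
  by apply: bigcup_measurable => n _; exact: measurable_ysection.
have LE : L = \bigcap_(N in setT) V N.
  apply/seteqP; split => x.
    move=> /ysectionP[Lx UU] N _; have [n Nn En] := Lx N I.
    by exists n => //; apply/ysectionP.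
  move=> Lx; apply/ysectionP; split.
    by move=> N _; have [n Nn /ysectionP[En _]] := Lx N I; exists n.
  by have [n _ /ysectionP[_]] := Lx 0%N I.
have mL : measurable L by rewrite LE; apply: bigcap_measurable => // N _.
have LU : L `<=` U by move=> x /ysectionP[_ []].
have mU : measurable U by exact: measurable_unit_itv.
have mUV N : measurable (U `\` V N) by apply: measurableD => //; exact: mV.
have UV0 N : lebesgue_measure (U `\` V N) = 0%E.
  apply/eqP; rewrite -measure_le0; apply/lee_addgt0Pr => eps eps0; rewrite add0e.
  have [n [S [Nn mS Seps ES]]] := HE eps eps0 N.
  apply: le_trans Seps; apply: le_measure.
  - by rewrite inE; exact: mUV.
  - by rewrite inE.
  move=> x [Ux nV]; apply: ES => // En; apply: nV; exists n => //.
  by apply/ysectionP.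
have UL0 : lebesgue_measure (U `\` L) = 0%E.
  rewrite LE setDE setC_bigcap setI_bigcupr.
  apply: measure_negligible.
    by apply: bigcup_measurable => N _; rewrite -setDE; exact: mUV.
  apply: negligible_bigcup => N; apply/negligibleP; rewrite -setDE.
  - exact: mUV.
  - exact: UV0.
have := measureDI lebesgue_measure mU mL.
rewrite setIidr//.
move=> /esym; rewrite [X in (X + _)%E]UL0 add0e => ->.
exact: lebesgue_unit_itv.
Qed.

Unset Implicit Arguments.

Theorem mainTheorem11 (R : realType) (T1 : R -> R) (alpha c : R)
  (varphi h : nat -> R) (r : nat -> R) :
  circ_mps T1 ->
  exp_mixing_BV_Linf T1 ->
  0 < c ->
  (forall q, 0 < varphi q) ->
  varphi q @[q --> \oo] --> +oo ->
  (exists Q : nat, forall q : nat, (Q <= q)%N -> forall p : int,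
      c * (ln q%:R * varphi q) / (q%:R ^+ 2) <= `| q%:R * alpha - p%:~R |) ->
  (forall n, 0 < r n) ->
  h n @[n --> \oo] --> +oo ->
  (h n / varphi n) @[n --> \oo] --> 0 ->
  (forall n, ln n%:R * h n / (n%:R ^+ 2) <= r n) ->
  ((@lebesgue_measure R \x @lebesgue_measure R)
     (limsup_sets (fun n => E_set T1 (circ_rot alpha) n (r n))
        `&` (@unit_itv R `*` @unit_itv R)) = 1)%E.
Proof.
move=> mps mix c0 phi0 phioo Hphi _ hoo _ Hr.
set E := fun n => E_set T1 _ n (r n); set U := @unit_itv R.
have mE n : measurable (E n `&` (U `*` U)) by exact: measurable_E_set.
have mL : measurable (limsup_sets E `&` (U `*` U)).
  rewrite (_ : _ `&` _ = \bigcap_(N in setT)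
      \bigcup_(n in [set n | (N <= n)%N]) (E n `&` (U `*` U))).
    apply: bigcap_measurable => // N _; apply: bigcup_measurable => n _.
    exact: mE.
  apply/seteqP; split => xy.
    by move=> [Exy UU] N _; have [n Nn En] := Exy N I; exists n.
  move=> Exy; split; last by have [n _ []] := Exy 0%N I.
  by move=> N _; have [n Nn []] := Exy N I; exists n.
(* The estimates are made for fixed [y], so the product measure is replaced by the one that
   integrates measures of y-sections; the two agree on rectangles. *)
rewrite (@product_measure_unique _ _ _ _ R lebesgue_measure lebesgue_measure
  (lebesgue_measure \x^ lebesgue_measure)%E)//; last first.
  by move=> A B mA mB; exact: product_measure2E.
rewrite /product_measure2/=.
(* The section at [y] has measure 1 for [y] in [U] and is empty otherwise. *)
transitivity (\int[lebesgue_measure]_y (\1_U y)%:E)%E; last first.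
  rewrite integral_indic//; last exact: measurable_unit_itv.
  by rewrite setIT; exact: lebesgue_unit_itv.
apply: eq_integral => y _ /=.
have [Uy|nUy] := pselect (U y).
  rewrite indicE mem_set//; apply: limsup_section_full => // eps eps0 N.
  exact: (non_hitting_small mps mix c0 phi0 phioo Hphi hoo Hr Uy).
rewrite indicE memNset//= (_ : ysection _ _ = set0) ?measure0//.
by apply/seteqP; split => // x /ysectionP[_ []].
Qed.
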